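(* For every graph $G$ and every end $\omega$ of $G$ the following assertions are equivalent: (i) The end space of $G$ is first countable at $\omega$. (ii) The direction $f_\omega$ is countably determined in $G$. (iii) The end $\omega$ is represented by a directional ray (that is, some ray in $\omega$ is directional in $G$). (iv) The end $\omega$ is represented by a topological ray (that is, some ray in $\omega$ is topological in $G$).
   Context: Graphs may be infinite of any cardinality. Countable means finite or countably infinite. A ray is a one-way infinite path. Two rays in $G$ are equivalent if no finite set of vertices separates them; the equivalence classes are the ends of $G$, and $\Omega(G)$ is the set of ends. For finite $X\subseteq V(G)$ and $\omega\in\Omega(G)$, $C(X,\omega)$ is the unique component of $G-X$ that contains a tail of every ray in $\omega$. For a component $C$ of $G-X$ let $\Omega(X,C)=\{\omega\in\Omega(G): C(X,\omega)=C\}$, and $\Omega(X,\omega):=\Omega(X,C(X,\omega))$. The end space of $G$ is $\Omega(G)$ with the topology having as a basis all sets $\Omega(X,C)$, with $X\subseteq V(G)$ finite and $C$ a component of $G-X$. A space is first countable at a point if it has a countable neighbourhood base at that point. A direction of $G$ is a map $f$ that assigns to every finite set $X\subseteq V(G)$ a component $f(X)$ of $G-X$ such that $f(X)\supseteq f(X')$ whenever $X\subseteq X'$. Every end $\omega$ defines a direction $f_\omega$ by $f_\omega(X)=C(X,\omega)$; a ray in $\omega$ is said to induce $f_\omega$. A directional choice in $G$ is a pair $(X,C)$ of a finite set $X\subseteq V(G)$ and a component $C$ of $G-X$. It distinguishes a direction $f$ from another direction $h$ if $f(X)=C$ and $h(X)\neq C$. A direction $f$ is countably determined in $G$ if there is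 a countable set of directional choices in $G$ that distinguish $f$ from every other direction of $G$. For a ray $R\subseteq G$, every finite initial segment of $R$, with vertex set $X$ say, defines the directional choice $(X,C)$ where $C$ is the component of $G-X$ containing $R-X$. The ray $R$ is directional in $G$ if the direction induced by $R$ is distinguished from every other direction of $G$ by the directional choices defined by the finite initial segments of $R$. The ray $R$, belonging to the end $\omega$, is topological in $G$ if $\{\Omega(X_n,\omega): n\in\mathbb N\}$ is a neighbourhood base of $\omega$ in $\Omega(G)$, where $X_n$ consists of the first $n$ vertices of $R$. *)

(* Defs.v *)
From HB Require Import structures.
From Stdlib Require Import Relation_Operators.
From mathcomp Require Import all_boot all_classical topology_structure.

Set Implicit Arguments.
Unset Strict Implicit.
Unset Printing Implicit Defensive.

Local Open Scope classical_set_scope.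

Record graph := Graph {
  vertex :> Type ;
  adj : vertex -> vertex -> Prop ;
  adj_sym : forall u v, adj u v -> adj v u ;
  adj_irrefl : forall v, ~ adj v v }.

Record finvset (V : Type) := FinVSet {
  vset :> set V ;
  vset_finite : finite_set vset }.

(* A ray has exactly one vertex of degree one, so as a subgraph it is the same
   thing as the sequence of its vertices, starting there. *)
Record ray (G : graph) := Ray {
  rayv :> nat -> G ;
  ray_inj : injective rayv ;
  ray_adj : forall n, adj (rayv n) (rayv n.+1) }.

Section Ends.
Variable G : graph.
Implicit Types (X Y : set G) (C D : set G) (R S : ray G).

(* [linked X u v]: u and v lie in G - X and are joined by a path of G - X. *)
Definition linked X (u v : G) : Prop :=
  ~ X u /\ clos_refl_trans G (fun x y => [/\ adj x y, ~ X x & ~ X y]) u v.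

(* Components of G - X are represented by their vertex sets. *)
Definition component X C : Prop :=
  exists2 v, ~ X v & C = [set u | linked X v u].

Definition separates X (A B : set G) : Prop :=
  forall a b, A a -> B b -> ~ linked X a b.

Definition ray_equiv R S : Prop :=
  forall X, finite_set X -> ~ separates X (range R) (range S).

Definition contains_tail C R : Prop :=
  exists n, forall m, (n <= m)%N -> C (R m).

Lemma linked_refl X u : ~ X u -> linked X u u.
Proof. by move=> Xu; split=> //; exact: rt_refl. Qed.

Lemma linked_trans X u v w : linked X u v -> linked X v w -> linked X u w.
Proof. by move=> [Xu uv] [_ vw]; split=> //; apply: rt_trans uv vw. Qed.

Lemma linked_sym X u v : linked X u v -> linked X v u.
Proof.
move=> [Xu uv]; elim: uv Xu => {u v} [x y [xy _ Xy]|x|x y z _ IH1 _ IH2] Xx.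
- split=> //; apply: rt_step; split=> //; exact: adj_sym.
- exact: linked_refl.
- by have yx := IH1 Xx; apply: (linked_trans _ yx); apply: IH2; case: yx.
Qed.

Lemma linkedS X Y u v : X `<=` Y -> linked Y u v -> linked X u v.
Proof.
move=> XY [Yu uv]; split; first by move/XY.
elim: uv {Yu} => {u v} [x y [xy Yx Yy]|x|x y z _ IH1 _ IH2].
- by apply: rt_step; split=> // /XY.
- exact: rt_refl.
- exact: rt_trans IH1 IH2.
Qed.

Lemma linked_out X u v : linked X u v -> ~ X v.
Proof. by move/linked_sym; case. Qed.

Lemma component_meet X C D v :
  component X C -> component X D -> C v -> D v -> C = D.
Proof.
move=> [c _ ->] [d _ ->] /= cv dv; apply/seteqP; split=> u /= h.
  by apply: linked_trans dv _; apply: linked_trans (linked_sym cv) _.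
by apply: linked_trans cv _; apply: linked_trans (linked_sym dv) _.
Qed.

Lemma component_sub X Y C D v : X `<=` Y ->
  component X C -> component Y D -> C v -> D v -> D `<=` C.
Proof.
move=> XY [c _ ->] [d _ ->] /= cv dv u /= du.
apply: linked_trans cv _; apply: linkedS XY _.
exact: linked_trans (linked_sym dv) du.
Qed.

Lemma ray_leaves R X : finite_set X -> exists n, forall m, (n <= m)%N -> ~ X (R m).
Proof.
move=> Xfin; have fin : finite_set (R @^-1` X).
  by apply: finite_preimage Xfin => i j _ _; exact: ray_inj.
have [s /seteqP[sub _]] := (finite_seqP (R @^-1` X)).1 fin.
exists (\max_(i <- s) i.+1) => m le_m XRm.
have ms : m \in s by exact: (sub m XRm).
have lt_m : (m < \max_(i <- s) i.+1)%N by exact: (@leq_bigmax_seq _ s xpredT succn m ms).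
by have := leq_trans lt_m le_m; rewrite ltnn.
Qed.

Lemma ray_linked R X n : (forall m, (n <= m)%N -> ~ X (R m)) ->
  forall m, (n <= m)%N -> linked X (R n) (R m).
Proof.
move=> out m le_nm; rewrite -(subnKC le_nm); elim: (m - n)%N => [|k IH].
  by rewrite addn0; apply: linked_refl; exact: out.
apply: linked_trans IH _; split; first by apply: out; exact: leq_addr.
apply: rt_step; rewrite addnS; split; first exact: ray_adj.
  by apply: out; exact: leq_addr.
by apply: out; rewrite -addnS; exact: leq_addr.
Qed.

Lemma ray_equiv_refl R : ray_equiv R R.
Proof.
move=> X Xfin; have [n out] := ray_leaves R Xfin.
by move/(_ (R n) (R n)); apply; try exact: linked_refl (out _ (leqnn n)); exists n.
Qed.

Lemma ray_equiv_sym R S : ray_equiv R S -> ray_equiv S R.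
Proof.
move=> RS X Xfin sep; apply: (RS X Xfin) => a b Ra Sb ab.
exact: sep Sb Ra (linked_sym ab).
Qed.

Lemma ray_equiv_tails R S X n : ray_equiv R S -> finite_set X ->
  (forall m, (n <= m)%N -> ~ X (R m)) -> contains_tail [set u | linked X (R n) u] S.
Proof.
move=> RS Xfin outR; have [k outS] := ray_leaves S Xfin.
suff nk : linked X (R n) (S k).
  by exists k => m km; apply: linked_trans nk _; exact: ray_linked km.
apply: contrapT => nnk; set Y := X `|` (R @` `I_n `|` S @` `I_k).
have Yfin : finite_set Y.
  by rewrite !finite_setU; do !split=> //; apply: finite_image; exact: finite_II.
apply: (RS Y Yfin) => _ _ [i _ <-] [j _ <-] ij; apply: nnk.
have ni : (n <= i)%N.
  by rewrite leqNgt; apply/negP => lt; case: ij => + _; apply; right; left; exists i.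
have kj : (k <= j)%N.
  rewrite leqNgt; apply/negP => lt; have := linked_out ij.
  by apply; right; right; exists j.
have ij' : linked X (R i) (S j) by apply: linkedS ij => v; left.
apply: linked_trans (ray_linked outR ni) _; apply: linked_trans ij' _.
exact: linked_sym (ray_linked outS kj).
Qed.

Lemma ray_equiv_trans R S T : ray_equiv R S -> ray_equiv S T -> ray_equiv R T.
Proof.
move=> RS ST X Xfin; have [k out] := ray_leaves S Xfin.
have [n /(_ n (leqnn n)) hR] := ray_equiv_tails (ray_equiv_sym RS) Xfin out.
have [m /(_ m (leqnn m)) hT] := ray_equiv_tails ST Xfin out.
by move/(_ (R n) (T m)); apply; try (by exists n); try (by exists m);
   exact: linked_trans (linked_sym hR) hT.
Qed.

Record graph_end := GraphEnd {
  end_rays : set (ray G) ;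
  end_class : exists R, end_rays = ray_equiv R }.

Definition end_of R : graph_end := GraphEnd (ex_intro _ R erefl).

Implicit Types w : graph_end.

Definition end_comp X w : set G :=
  xget set0 [set C | component X C /\
                     forall R, end_rays w R -> contains_tail C R].

Lemma end_comp_exists X w : finite_set X ->
  exists! C, component X C /\ forall R, end_rays w R -> contains_tail C R.
Proof.
case: w => /= W [R WE] Xfin; subst W; have [n out] := ray_leaves R Xfin.
exists [set u | linked X (R n) u]; split.
  split; first by exists (R n) => //; exact: out.
  by move=> S RS; exact: ray_equiv_tails out.
move=> D [compD /(_ R (@ray_equiv_refl R)) [k tailD]].
apply: (@component_meet X _ _ (R (maxn n k))) => //.
- by exists (R n) => //; exact: out.
- by apply: ray_linked => //; exact: leq_maxl.
- by apply: tailD; exact: leq_maxr.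
Qed.

Lemma end_compP X w : finite_set X ->
  component X (end_comp X w) /\
  forall R, end_rays w R -> contains_tail (end_comp X w) R.
Proof.
by move=> Xfin; have [C [PC _]] := end_comp_exists w Xfin; exact: (@xgetPex _ set0 [set C | _] (ex_intro _ C PC)).
Qed.

Lemma end_compS X Y w : finite_set X -> finite_set Y -> X `<=` Y ->
  end_comp Y w `<=` end_comp X w.
Proof.
move=> Xfin Yfin XY; have [compX tailX] := end_compP w Xfin.
have [compY tailY] := end_compP w Yfin; have [R WE] := end_class w.
have wR : end_rays w R by rewrite WE; exact: ray_equiv_refl.
have [n hX] := tailX R wR; have [m hY] := tailY R wR.
apply: (@component_sub X Y _ _ (R (maxn n m))) => //.
  by apply: hX; exact: leq_maxl.
by apply: hY; exact: leq_maxr.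
Qed.

Definition Omega X C : set graph_end := [set w | end_comp X w = C].

Definition Omega_at X w : set graph_end := Omega X (end_comp X w).

Definition end_base : set (set graph_end) :=
  [set U | exists2 X, finite_set X & exists2 C, component X C & U = Omega X C].

Lemma end_base_cover : \bigcup_(U in end_base) id U = setT.
Proof.
apply/seteqP; split=> // w _; exists (Omega_at set0 w); last by [].
exists set0; first exact: finite_set0.
by exists (end_comp set0 w) => //; exact: (end_compP w (finite_set0 _)).1.
Qed.

Lemma end_base_join (U V : set graph_end) w :
  end_base U -> end_base V -> id U w -> id V w ->
  exists W, [/\ end_base W, id W w & id W `<=` id U `&` id V].
Proof.
move=> [X Xfin [C compC ->]] [Y Yfin [D compD ->]] /= wC wD.
have Zfin : finite_set (X `|` Y) by rewrite finite_setU.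
have [compE _] := end_compP w Zfin.
have key T w' : finite_set T -> T `<=` X `|` Y ->
    Omega_at (X `|` Y) w w' -> end_comp T w' = end_comp T w.
  move=> Tfin TZ eqE; have [e Ze eE] := compE.
  have Ee : end_comp (X `|` Y) w e by rewrite eE; exact: linked_refl.
  apply: (@component_meet T _ _ e).
  - exact: (end_compP w' Tfin).1.
  - exact: (end_compP w Tfin).1.
  - by apply: (end_compS Tfin Zfin TZ); rewrite eqE.
  - exact: (end_compS Tfin Zfin TZ).
exists (Omega_at (X `|` Y) w); split=> //.
  by exists (X `|` Y) => //; exists (end_comp (X `|` Y) w).
move=> w' ww'; split; rewrite /Omega /=.
  by rewrite (key X w' Xfin _ ww').
by rewrite (key Y w' Yfin _ ww').
Qed.

Record direction := Direction {
  dirv :> finvset G -> set G ;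
  dir_component : forall X : finvset G, component X (dirv X) ;
  dir_sub : forall X Y : finvset G, X `<=` Y -> dirv Y `<=` dirv X }.

Definition end_direction w : direction :=
  @Direction (fun X : finvset G => end_comp X w)
    (fun X : finvset G => (end_compP w (vset_finite X)).1)
    (fun X Y : finvset G => end_compS (vset_finite X) (vset_finite Y)).

Definition directional_choice (c : finvset G * set G) : Prop :=
  component c.1 c.2.

Definition distinguishes (c : finvset G * set G) (f h : direction) : Prop :=
  f c.1 = c.2 /\ h c.1 <> c.2.

(* For every h some choice in D tells f from h; the choice may depend on h. *)
Definition distinguishes_from_others
    (D : set (finvset G * set G)) (f : direction) : Prop :=
  forall h : direction, h <> f -> exists2 c, D c & distinguishes c f h.

Definition countably_determined (f : direction) : Prop :=
  exists D : set (finvset G * set G),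
    [/\ countable D, D `<=` directional_choice & distinguishes_from_others D f].

Definition first_vertices R (n : nat) : set G := R @` `I_n.

(* A path has at least one vertex, hence n.+1. *)
Definition ray_choices R : set (finvset G * set G) :=
  [set c | directional_choice c /\
    exists2 n, vset c.1 = first_vertices R n.+1 & range R `\` c.1 `<=` c.2].

Definition directional_ray R : Prop :=
  distinguishes_from_others (ray_choices R) (end_direction (end_of R)).

End Ends.

HB.instance Definition _ (G : graph) := gen_eqMixin (graph_end G).
HB.instance Definition _ (G : graph) := gen_choiceMixin (graph_end G).
HB.instance Definition _ (G : graph) :=
  isBaseTopological.Build (graph_end G) (@end_base_cover G) (@end_base_join G).

Lemma end_base_basis (G : graph) : basis (@end_base G).
Proof.
have base_open : @end_base G `<=` open.
  by move=> U baseU; exists [set U]; [move=> V -> | rewrite bigcup_set1].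
split=> // w A; rewrite nbhsE => -[B [[D Dbase BE] Bw] BA].
move: Bw; rewrite -BE => -[U DU Uw]; exists U; first by split=> //; exact: Dbase.
by move=> v Uv; apply: BA; rewrite -BE; exists U.
Qed.

Definition nbhs_base (T : topologicalType) (x : T) (B : set (set T)) : Prop :=
  B `<=` nbhs x /\ forall U, nbhs x U -> exists2 V, B V & V `<=` U.

Definition first_countable_at (T : topologicalType) (x : T) : Prop :=
  exists2 B : set (set T), countable B & nbhs_base x B.

Definition topological_ray (G : graph) (R : ray G) : Prop :=
  nbhs_base (end_of R)
    (range (fun n => Omega_at (first_vertices R n) (end_of R))).

(* Main.v *)
(* The heart of the proof is [direction_ray]: given a direction [h] and countably
   many vertices y_0, y_1, ..., there is a ray R, each vertex of which lies in the
   component that [h] assigns to the set of its predecessors, such that every y_k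
   either lies on R or is separated from [h] by a finite initial segment of R.  One
   builds R greedily, walking towards y_k until it is reached or cut off.

   (ii) => (iii): let the y_k enumerate all vertices of the given directional
   choices and of a ray S of w.  Then R meets S infinitely often, so R lies in w.
   For every choice (Y, C) with f_w(Y) = C, a finite initial segment X_n of R
   has f_w(X_n) disjoint from Y, so h(X_n) = f_w(X_n) forces h(Y) = f_w(Y).

   (i) => (ii): by [direction_ray], every component chosen by a direction contains
   a ray, so a direction agrees with some end on any given finite collection of
   finite sets.

   (iii) => (iv): given X, choose N such that every vertex of X lying in C(X_N, w)
   lies in all C(X_m, w).  If an end in C(X_N, w) is not in C(X, w), its component
   avoids R and is joined to such a vertex of X, so all C(X_m, w) contain that end
   and R does not distinguish its direction from f_w. *)

Require Import Defs.
From Stdlib Require Import Relation_Operators.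
From mathcomp Require Import all_boot all_classical topology_structure.

Set Implicit Arguments.
Unset Strict Implicit.
Unset Printing Implicit Defensive.

Local Open Scope classical_set_scope.

(** * Enumerations and uniform bounds *)

Lemma countable_enum (T : Type) (A : set T) (x0 : T) :
  countable A -> exists y : nat -> T, forall x, A x -> exists n, y n = x.
Proof.
move=> /countable_injP[g g_inj].
have [y yP] : exists y : nat -> T, forall n x, A x -> g x = n -> y n = x.
  suff /choice[y yP] : forall n, exists z, forall x, A x -> g x = n -> z = x.
    by exists y.
  move=> n; have [[x [Ax gx]]|no] := pselect (exists x, A x /\ g x = n).
    exists x => x' Ax' gx'; apply: g_inj; rewrite ?inE //.
    by rewrite gx gx'.
  by exists x0 => x Ax gx; case: no; exists x.
by exists y => x Ax; exists (g x); exact: yP.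
Qed.

Lemma finite_set_eventually (T : Type) (A : set T) (P : T -> nat -> Prop) :
  finite_set A -> (forall x m n, (m <= n)%N -> P x m -> P x n) ->
  (forall x, A x -> exists n, P x n) -> exists n, forall x, A x -> P x n.
Proof.
move=> Afin Pmono PA.
have [f fP] : exists f : T -> nat, forall x, A x -> P x (f x).
  suff /choice[f fP] : forall x, exists n, A x -> P x n by exists f.
  move=> x; have [/PA[n Pn]|nAx] := pselect (A x); first by exists n.
  by exists 0%N.
have [s /seteqP[sub _]] := (finite_seqP (f @` A)).1 (finite_image f Afin).
exists (\max_(i <- s) i)%N => x Ax; apply: Pmono (fP x Ax).
by apply: (@leq_bigmax_seq _ s xpredT id) => //; apply: sub; exists x.
Qed.

(** * Walks and components of [G - X] *)

Section Graph.
Variable G : graph.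
Implicit Types (X Y C : set G) (R S : ray G).

(** The explicit length [n] is what the greedy construction of a ray recurses on. *)
Fixpoint walk X n (u v : G) : Prop :=
  if n is m.+1 then exists2 x, walk X m u x & adj x v /\ ~ X v
  else u = v /\ ~ X v.

Lemma linked_adj X u x y : linked X u x -> adj x y -> ~ X y -> linked X u y.
Proof.
move=> ux xy Xy; have Xx := linked_out ux; apply: linked_trans ux _.
by split=> //; apply: rt_step.
Qed.

Lemma linked_walk X u v : linked X u v -> exists n, walk X n u v.
Proof.
have walk_cat m n x y z : walk X m x y -> walk X n y z -> walk X (n + m) x z.
  move=> xy; elim: n z => [|n IH] z /= => [[<-]//|[t yt tz]].
  by exists t => //; exact: IH.
case=> Xu uv; elim: uv Xu => {u v} [x y [xy _ Xy]|x|x y z xy IH1 yz IH2] Xx.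
- by exists 1%N, x.
- by exists 0%N.
- have [m wm] := IH1 Xx; have Xy : ~ X y by exact: (@linked_out _ X x).
  by have [n wn] := IH2 Xy; exists (n + m)%N; exact: walk_cat wm wn.
Qed.

Lemma walk_linked X n u v : walk X n u v -> linked X u v.
Proof.
elim: n v => [|n IH] v /=; first by case=> -> Xv; exact: linked_refl.
by case=> x /IH ux [xv Xv]; exact: linked_adj xv Xv.
Qed.

Lemma linked_exit X (A : set G) u v : linked X u v -> A u -> ~ A v ->
  exists x y, [/\ linked X u x, adj x y, A x, ~ A y & ~ X y].
Proof.
move=> /linked_walk[n]; elim: n v => [|n IH] v /=; first by case=> ->.
case=> x uxw [xv Xv] Au Av; have [Ax|/(IH x uxw Au)//] := pselect (A x).
by exists x, v; split=> //; exact: walk_linked uxw.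
Qed.

(** Otherwise the path leaves the component of [u] in [G - Y] along an edge whose far end lies in
    [Y], against the hypothesis. *)
Lemma linked_avoid X Y u v : linked X u v ->
  (forall z, linked X u z -> ~ Y z) -> linked Y u v.
Proof.
move=> uv avoid; apply: contrapT => nuv.
have Xu := uv.1; have Yu := avoid u (linked_refl Xu).
have [x [y [ux xy Yux Yuy Xy]]] :=
  linked_exit (A := [set z | linked Y u z]) uv (linked_refl Yu) nuv.
by apply: Yuy; apply: (linked_adj Yux xy); apply: avoid; exact: linked_adj xy Xy.
Qed.

(* [q] is the vertex after the last visit of the walk to [p]. *)
Lemma walk_leave X n p v : walk X n p v -> v <> p ->
  exists q k, [/\ (k < n)%N, adj p q & walk (X `|` [set p]) k q v].
Proof.
elim: n v => [|n IH] v /= => [[->]//|[x px [xv Xv]] vp].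
have Zv : ~ (X `|` [set p]) v by move=> [].
have [xp|xp] := pselect (x = p).
  by exists v, 0%N; split=> //; rewrite -xp.
by have [q [k [kn pq qx]]] := IH x px xp; exists q, k.+1; split=> //; exists x.
Qed.

Lemma component_linked X C u v : component X C -> C u -> C v -> linked X u v.
Proof. by case=> c _ -> cu cv; exact: linked_trans (linked_sym cu) cv. Qed.

Lemma component_closed X C u v : component X C -> C u -> linked X u v -> C v.
Proof. by case=> c _ -> cu uv; exact: linked_trans cu uv. Qed.

Lemma component_out X C u : component X C -> C u -> ~ X u.
Proof. by case=> c _ -> /linked_out. Qed.

Lemma component_nonempty X C : component X C -> exists v, C v.
Proof. by case=> c Xc ->; exists c; exact: linked_refl. Qed.

Lemma component_adj X C u v : component X C -> C u -> adj u v -> ~ X v -> C v.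
Proof.
move=> compC Cu uv Xv; apply: (component_closed compC Cu).
by apply: linked_adj uv Xv; apply: linked_refl; exact: component_out Cu.
Qed.

(** * Ends and directions *)

Lemma end_comp_unique X (w : graph_end G) C R : finite_set X -> component X C ->
  end_rays w R -> contains_tail C R -> end_comp X w = C.
Proof.
move=> Xfin compC wR [n tailC]; have [compX /(_ R wR)[m tailX]] := end_compP w Xfin.
apply: (component_meet compX compC (v := R (maxn n m))).
  by apply: tailX; exact: leq_maxr.
by apply: tailC; exact: leq_maxl.
Qed.

Lemma end_rays_end_of R : end_rays (end_of R) R.
Proof. exact: ray_equiv_refl. Qed.

Lemma end_of_ray (w : graph_end G) R : end_rays w R -> w = end_of R.
Proof.
case: w => W [S WE] /= WR; subst W.
have eqRS : ray_equiv S = ray_equiv R.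
  apply/funext => T; apply/propext; split; apply: ray_equiv_trans => //.
  exact: ray_equiv_sym.
rewrite /end_of; move: (ex_intro _ R _) => p.
by move: (ex_intro _ S _) p; rewrite eqRS => p q; congr GraphEnd; exact: Prop_irrelevance.
Qed.

Lemma direction_ext (f h : direction G) :
  (forall X : finvset G, f X = h X) -> f = h.
Proof.
case: f h => f cf sf [h ch sh] /= /funext fh; subst h.
by congr Direction; exact: Prop_irrelevance.
Qed.

Lemma direction_vset (h : direction G) (X Y : finvset G) :
  vset X = vset Y -> h X = h Y.
Proof. by move=> XY; apply/seteqP; split; apply: dir_sub; rewrite XY. Qed.

(** * Greedy construction of a ray following a direction *)

Lemma seg_finite (X : finvset G) (r : nat -> G) n : finite_set (X `|` r @` `I_n).
Proof.
rewrite finite_setU; split; first exact: vset_finite.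
by apply: finite_image; exact: finite_II.
Qed.

(** The base set [X] keeps the ray inside [h X]; for empty [X] these are the initial segments of the
    ray. *)
Definition seg (X : finvset G) (r : nat -> G) n : finvset G :=
  FinVSet (seg_finite X r n).

Lemma segS (X : finvset G) r n : vset (seg X r n.+1) = seg X r n `|` [set r n].
Proof. by rewrite /= -setUA IIS image_setU image_set1. Qed.

Lemma eq_seg (X : finvset G) r r' n : (forall i, (i < n)%N -> r' i = r i) ->
  vset (seg X r' n) = vset (seg X r n).
Proof. by move=> eq_r; congr (_ `|` _); apply: eq_imagel => i /eq_r. Qed.

Lemma seg_sub (X : finvset G) r m n : (m <= n)%N -> seg X r m `<=` seg X r n.
Proof.
move=> mn v [Xv|[i im <-]]; first by left.
by right; exists i => //=; exact: leq_trans mn.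
Qed.

(** A path in [h X] from [v] to [h Y] enters [h Y] along some edge. Its outer end must be [v], since
    any other vertex outside [X] adjacent to [h Y] belongs to [h Y]. *)
Lemma direction_neighbour (h : direction G) (X Y : finvset G) v :
  vset Y = X `|` [set v] -> h X v -> exists2 u, adj v u & h Y u.
Proof.
move=> YE hXv; have compX := dir_component h X; have compY := dir_component h Y.
have XY : X `<=` Y by rewrite YE; exact: subsetUl.
have Yv : vset Y v by rewrite YE; right.
have [u hYu] := component_nonempty compY.
have vu := component_linked compX hXv (dir_sub XY hYu).
have nv : (~` h Y) v by move=> /(component_out compY).
have [x [y [vx xy nx /contrapT hYy Xy]]] := linked_exit vu nv (fun k => k hYu).
have [<-|xv] := pselect (x = v); first by exists y.
case: nx; apply: (component_adj compY hYy (adj_sym xy)).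
by rewrite YE => -[|//]; exact: linked_out vx.
Qed.

Section DirectionRay.
Variables (h : direction G) (X : finvset G).
Implicit Types r : nat -> G.

(** A state of the construction is a pair [(r, n)] in which only the values of [r] up to [n]
    matter. *)
Definition along r n : Prop :=
  forall i, (i <= n)%N -> h (seg X r i) (r i) /\ ((i < n)%N -> adj (r i) (r i.+1)).

Definition extends r n r' n' : Prop :=
  (n <= n')%N /\ forall i, (i <= n)%N -> r' i = r i.

Definition settled (y : G) r n : Prop :=
  (exists2 i, (i <= n)%N & r i = y) \/ ~ h (seg X r n.+1) y.

Lemma extends_trans r n r' n' r'' n'' :
  extends r n r' n' -> extends r' n' r'' n'' -> extends r n r'' n''.
Proof.
move=> [nn' e] [nn'' e']; split; first exact: leq_trans nn''.
by move=> i i_n; rewrite e' ?e //; exact: leq_trans nn'.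
Qed.

Lemma along_eq r r' n : (forall i, (i <= n)%N -> r' i = r i) -> along r n -> along r' n.
Proof.
move=> e rn i i_n; have [hi ai] := rn i i_n; split.
  rewrite e // (direction_vset _ (Y := seg X r i)) //; apply: eq_seg => j ji.
  by apply: e; apply: leq_trans i_n; exact: ltnW.
by move=> lt; rewrite !e //; exact: ai.
Qed.

Lemma settled_extends y r n r' n' :
  extends r n r' n' -> settled y r n -> settled y r' n'.
Proof.
move=> [nn' e] [[i i_n <-]|nh]; [left|right].
  by exists i; [exact: leq_trans nn'|exact: e].
move=> hy; apply: nh; rewrite -(direction_vset _ (X := seg X r' n.+1)).
  by apply: dir_sub hy; exact: seg_sub.
exact: eq_seg.
Qed.

Lemma along_rcons r n u : along r n -> adj (r n) u -> h (seg X r n.+1) u ->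
  exists r', [/\ extends r n r' n.+1, along r' n.+1 & r' n.+1 = u].
Proof.
move=> rn nu hu; pose r' i := if i == n.+1 then u else r i.
have e i : (i <= n)%N -> r' i = r i by rewrite /r'; case: eqP => // ->; rewrite ltnn.
have un : r' n.+1 = u by rewrite /r' eqxx.
exists r'; split=> // i; rewrite leq_eqVlt => /orP[/eqP->|].
  split; last by rewrite ltnn.
  by rewrite un (direction_vset _ (Y := seg X r n.+1)) //; exact: eq_seg.
rewrite ltnS => i_n; have [hi ai] := along_eq e rn i_n; split=> // _.
move: i_n; rewrite leq_eqVlt => /orP[/eqP->|]; last exact: ai.
by rewrite un e.
Qed.

(* As long as [y] is not cut off, the neighbour of [r n] through which the walk
   leaves [r n] for the last time lies in the same component as [y], so it may be
   appended; the remaining walk is shorter. *)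
Lemma along_walk d r n y : along r n -> walk (seg X r n) d (r n) y ->
  exists r' n', [/\ extends r n r' n', along r' n' & settled y r' n'].
Proof.
elim/ltn_ind: d r n => d IH r n rn wy.
have [yn|yn] := pselect (y = r n).
  by exists r, n; split=> //; left; exists n.
have [hy|nhy] := pselect (h (seg X r n.+1) y); last first.
  by exists r, n; split=> //; right.
have [q [k [kd nq qy]]] := walk_leave wy yn.
rewrite -segS in qy.
have hq : h (seg X r n.+1) q.
  exact: component_closed (dir_component _ _) hy (linked_sym (walk_linked qy)).
have [r' [rr' rn' r'q]] := along_rcons rn nq hq.
have [|r'' [m [e am sm]]] := IH k kd r' n.+1 rn'.
  by rewrite r'q (eq_seg _ (r := r)) // => i; exact: rr'.2.
by exists r'', m; split=> //; exact: extends_trans e.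
Qed.

Lemma along_settle r n y : along r n ->
  exists r' n', [/\ (n < n')%N, extends r n r' n', along r' n' & settled y r' n'].
Proof.
move=> rn; have [hn _] := rn n (leqnn n).
have [r1 [n1 [e1 a1 s1]]] :
    exists r' n', [/\ extends r n r' n', along r' n' & settled y r' n'].
  have [hy|nhy] := pselect (h (seg X r n) y).
    have /linked_walk[d wd] := component_linked (dir_component h _) hn hy.
    exact: along_walk wd.
  exists r, n; split=> //; right => hy; apply: nhy.
  by apply: dir_sub hy; exact: seg_sub.
have [h1 _] := a1 n1 (leqnn n1).
(* Settling [y] may append nothing; one more vertex forces strict growth, so the limit is
   infinite. *)
have [u nu hu] := direction_neighbour (segS X r1 n1) h1.
have [r2 [e2 a2 _]] := along_rcons a1 nu hu.
exists r2, n1.+1; split=> //.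
- by rewrite ltnS; exact: e1.1.
- exact: extends_trans e2.
- exact: settled_extends s1.
Qed.

Lemma along_ray r : (forall n, along r n) ->
  exists2 R : ray G, rayv R = r & forall n, h (seg X R n) (R n).
Proof.
move=> r_along.
have r_in n : h (seg X r n) (r n) by have [] := r_along n n (leqnn n).
have r_lt i j : (i < j)%N -> r i <> r j.
  (* [r j] lies in a component that avoids all its predecessors, [r i] among them. *)
  move=> ij e; apply: (component_out (dir_component h _) (r_in j)).
  by right; exists i.
have r_inj : injective r.
  by move=> i j rij; case: (ltngtP i j) => // /r_lt; rewrite rij.
have r_adj n : adj (r n) (r n.+1) by have [_] := r_along n.+1 n (leqnSn n); apply.
by exists (Ray r_inj r_adj).
Qed.

Lemma direction_ray (y : nat -> G) : exists R : ray G,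
  (forall n, h (seg X R n) (R n)) /\
  forall k, range R (y k) \/ exists n, ~ h (seg X R n) (y k).
Proof.
pose state := ((nat -> G) * nat)%type.
have [F FP] : exists F : nat * state -> state, forall k s, along s.1 s.2 ->
    let s' := F (k, s) in [/\ (s.2 < s'.2)%N, extends s.1 s.2 s'.1 s'.2,
      along s'.1 s'.2 & settled (y k) s'.1 s'.2].
  suff /choice[F FP] : forall ks : nat * state, exists s' : state,
      along ks.2.1 ks.2.2 -> [/\ (ks.2.2 < s'.2)%N, extends ks.2.1 ks.2.2 s'.1 s'.2,
      along s'.1 s'.2 & settled (y ks.1) s'.1 s'.2].
    by exists F => k s; exact: (FP (k, s)).
  case=> k [r n] /=; have [rn|nrn] := pselect (along r n); last by exists (r, n).
  by have [r' [n' P]] := along_settle (y k) rn; exists (r', n').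
have [v hv] := component_nonempty (dir_component h X).
pose st := fix st k := if k is k'.+1 then F (k', st k') else (fun=> v, 0%N) : state.
have st_along k : along (st k).1 (st k).2.
  elim: k => [|k IH] /=; last by have [] := FP k _ IH.
  move=> i; rewrite leqn0 => /eqP->; split=> //=.
  rewrite (direction_vset _ (Y := X)) //=.
  by rewrite II0 image_set0 setU0.
have st_size k : (k <= (st k).2)%N.
  elim: k => //= k IH; have [lt _ _ _] := FP k _ (st_along k).
  exact: leq_ltn_trans lt.
have st_ext k l : (k <= l)%N -> extends (st k).1 (st k).2 (st l).1 (st l).2.
  move=> /subnKC<-; elim: (l - k)%N => [|m IH]; first by rewrite addn0; split.
  rewrite addnS /=; have [_ e _ _] := FP (k + m)%N _ (st_along (k + m)%N).
  exact: extends_trans e.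
(* Diagonal limit: stage [i] has already fixed the value at [i], and later stages only extend it. *)
pose r i := (st i).1 i.
have rE k i : (i <= (st k).2)%N -> r i = (st k).1 i.
  move=> ik; have [/st_ext[_ e]|/ltnW/st_ext[_ e]] := leqP k i; first exact: e.
  by rewrite e //; exact: st_size.
have r_along n : along r n.
  apply: (along_eq (r := (st n).1)).
    by move=> i i_n; apply: (rE n); exact: leq_trans (st_size n).
  move=> i i_n; have i_st := leq_trans i_n (st_size n).
  have [hi ai] := st_along n i i_st; split=> // lt; apply: ai.
  exact: leq_trans (st_size n).
have [R Rr R_in] := along_ray r_along; exists R; split=> // k; rewrite Rr.
have [_ _ _ sk] := FP k _ (st_along k).
have e : extends (st k.+1).1 (st k.+1).2 r (st k.+1).2.
  by split=> // i; exact: (rE k.+1).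
have [[i _ <-]|nh] := settled_extends e sk.
- by left; exists i.
- by right; exists (st k.+1).2.+1.
Qed.

End DirectionRay.

(** * Approximation of directions by ends; (i) => (ii) *)

Lemma direction_agreeS (f h : direction G) (X Y : finvset G) :
  X `<=` Y -> f Y = h Y -> f X = h X.
Proof.
move=> XY fhY; have [v fv] := component_nonempty (dir_component f Y).
apply: (component_meet (dir_component f X) (dir_component h X) (v := v)).
  exact: dir_sub fv.
by rewrite fhY in fv; exact: dir_sub fv.
Qed.

Lemma ray_end_comp X R n : finite_set X -> (forall m, (n <= m)%N -> ~ X (R m)) ->
  end_comp X (end_of R) (R n).
Proof.
move=> Xfin out.
have [compX /(_ R (@end_rays_end_of R))[m tailX]] := end_compP (end_of R) Xfin.
apply: (component_closed compX (tailX (maxn n m) (leq_maxr _ _))).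
by apply: linked_sym; apply: ray_linked => //; exact: leq_maxl.
Qed.

Lemma end_comp_ray X C R : finite_set X -> component X C ->
  contains_tail C R -> end_comp X (end_of R) = C.
Proof. by move=> Xfin compC; apply: end_comp_unique => //; exact: end_rays_end_of. Qed.

(** A ray that follows [h] from the base set [X] stays in [h X], hence in every such [h Y]; its end
    is the witness. *)
Lemma direction_end (h : direction G) (X : finvset G) :
  exists e : graph_end G, forall Y : finvset G, Y `<=` X -> end_comp Y e = h Y.
Proof.
have [v _] := component_nonempty (dir_component h X).
have [R [hR _]] := direction_ray h X (fun=> v).
exists (end_of R) => Y YX; apply: end_comp_ray; [exact: vset_finite|exact: dir_component|].
exists 0%N => m _; apply: (dir_sub (Y := seg X R m)) (hR m).
by apply: subset_trans YX _ => u Xu; left.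
Qed.

Lemma nbhs_end (w : graph_end G) (V : set (graph_end G)) :
  nbhs w V <-> exists X : finvset G, Omega_at X w `<=` V.
Proof.
have [open_base base] := end_base_basis G; split.
  move=> /base[U [[X Xfin [C _ ->]] wC] UV]; exists (FinVSet Xfin) => e.
  by rewrite /Omega_at /Omega /= => eC; apply: UV; rewrite /Omega /= eC; exact: wC.
case=> X XV; apply: filterS XV _; apply: open_nbhs_nbhs; split=> //.
apply: open_base; exists X; first exact: vset_finite.
by exists (end_comp X w) => //; exact: (end_compP w (vset_finite X)).1.
Qed.

Lemma first_countable_determined (w : graph_end G) :
  first_countable_at w -> countably_determined (end_direction w).
Proof.
case=> B Bct [Bnbhs Bbase].
have [F FB] : exists F : set (graph_end G) -> finvset G,
    forall V, B V -> Omega_at (F V) w `<=` V.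
  suff /choice[F FB] : forall V, exists X : finvset G, B V -> Omega_at X w `<=` V.
    by exists F.
  move=> V; have [/Bnbhs/nbhs_end[X XV]|nBV] := pselect (B V); first by exists X.
  by exists (FinVSet (finite_set0 G)).
pose c V := (F V, end_comp (F V) w).
exists (c @` B); split.
- by apply: sub_countable Bct; exact: card_image_le.
- by move=> _ [V _ <-]; exact: (end_compP w (vset_finite _)).1.
move=> h hw; apply: contrapT => agree; apply: hw; apply: direction_ext => Y /=.
have [V BV VY] : exists2 V, B V & V `<=` Omega_at Y w.
  by apply: Bbase; apply/nbhs_end; exists Y.
have hV : h (F V) = end_comp (F V) w.
  by apply: contrapT => ne; apply: agree; exists (c V); [exists V|split].
have XYfin : finite_set (F V `|` Y).
  by rewrite finite_setU; split; exact: vset_finite.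
(* An end agreeing with [h] on both [F V] and [Y] lies in [V], hence in [Omega_at Y w], which
   transfers the value at [Y] to [h]. *)
have [e he] := direction_end h (FinVSet XYfin).
have eV : V e.
  by apply: FB => //; rewrite /Omega_at /Omega /= he ?hV //=; exact: subsetUl.
by have := VY e eV; rewrite /Omega_at /Omega /= he //=; exact: subsetUr.
Qed.

(** * Directional rays; (ii) => (iii) *)

Lemma first_vertices_finite R n : finite_set (first_vertices R n).
Proof. by apply: finite_image; exact: finite_II. Qed.

Definition initial R n : finvset G := FinVSet (first_vertices_finite R n).

Lemma initial_sub R m n : (m <= n)%N -> initial R m `<=` initial R n.
Proof. by move=> mn _ [i im <-]; exists i => //=; exact: leq_trans mn. Qed.

Lemma initial_end_comp R m n : (n <= m)%N ->
  end_comp (initial R n) (end_of R) (R m).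
Proof.
move=> nm; apply: ray_end_comp; first exact: vset_finite.
move=> k mk [i /= lt_in /ray_inj ik]; move: (leq_trans nm mk).
by rewrite -ik leqNgt lt_in.
Qed.

Lemma directional_rayP R : directional_ray R <->
  forall h : direction G, (forall n, h (initial R n) = end_comp (initial R n) (end_of R)) ->
    h = end_direction (end_of R).
Proof.
split=> dirR h.
  move=> agree; apply: contrapT => /dirR[[X C] /= [_ [n XE _]] [/= fX hX]].
  by apply: hX; rewrite -fX (direction_vset h (Y := initial R n.+1)) // agree XE.
move=> ne; apply: contrapT => agree; apply: ne; apply: dirR => n.
(* Ray choices begin with one vertex, so agreement at [n] is drawn from the larger segment. *)
suff e : h (initial R n.+1) = end_direction (end_of R) (initial R n.+1).
  exact: direction_agreeS (initial_sub (leqnSn n)) e.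
apply: contrapT => ne; apply: agree.
exists (initial R n.+1, end_comp (initial R n.+1) (end_of R)); last by split.
split; first exact: (end_compP _ (vset_finite _)).1.
exists n => // _ [[i _ <-] nXi] /=; apply: initial_end_comp.
by rewrite leqNgt; apply/negP => lt; apply: nXi; exists i.
Qed.

Lemma determined_directional (w : graph_end G) :
  countably_determined (end_direction w) ->
  exists2 R : ray G, end_rays w R & directional_ray R.
Proof.
case=> D [Dct _ Ddist]; have [S wE] := end_class w.
have wS : end_rays w S by rewrite wE; exact: ray_equiv_refl.
pose U := \bigcup_(c in D) vset c.1 `|` range S.
have Uct : countable U.
  rewrite /U -bigcup2E; apply: bigcup_countable => // -[|[|i]] _ //=.
    by apply: bigcup_countable => // c _; apply: finite_set_countable; exact: vset_finite.
  by apply: sub_countable (countableP setT); exact: card_image_le.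
have [y yP] := countable_enum (S 0%N) Uct.
pose f := end_direction w.
have [R [_ Rset]] := direction_ray f (FinVSet (finite_set0 G)) y.
have {y yP}Rset v : U v -> range R v \/ exists n, ~ f (initial R n) v.
  case/yP => k <-; have [Rv|[n nfv]] := Rset k; [by left|right; exists n].
  by rewrite (direction_vset f (Y := seg (FinVSet (finite_set0 G)) R n)) //= set0U.
(* If [R] missed the tail of [S] from [k] on, no initial segment of [R] could cut [S k] off from
   [w], so [S k] would lie on [R]. *)
have meets k : exists2 j, (k <= j)%N & range R (S j).
  apply: contrapT => no.
  have nR j : (k <= j)%N -> ~ range R (S j) by move=> kj Rj; apply: no; exists j.
  have US : U (S k) by right; exists k.
  have [/(nR k (leqnn k))//|[n]] := Rset _ US; apply.
  rewrite /f /= (end_of_ray wS).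
  apply: ray_end_comp; first exact: first_vertices_finite.
  by move=> m /nR nRm [i _ Ri]; apply: nRm; exists i.
have wR : end_rays w R.
  rewrite wE => X Xfin sep; have [b out] := ray_leaves S Xfin.
  have [j bj RSj] := meets b.
  by apply: (sep (S j) (S j)); [exists j|exact: RSj|apply: linked_refl; exact: out].
exists R => //; apply/directional_rayP => h; rewrite -(end_of_ray wR) => agree.
apply: contrapT => /Ddist[[Y C] DYC [/= fY hY]]; apply: hY.
have [N out] : exists N, forall v, vset Y v -> ~ f (initial R N) v.
  apply: finite_set_eventually; first exact: vset_finite.
    move=> v m n mn nfm fn; apply: nfm.
    by apply: dir_sub fn; exact: initial_sub.
  move=> v Yv; have [|[i _ <-]|] := Rset v; [by left; exists (Y, C)| |by []].
  exists i.+1 => /(component_out (dir_component _ _)); apply.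
  by exists i => /=.
have Zfin : finite_set (Y `|` initial R N).
  by rewrite finite_setU; split; exact: vset_finite.
pose Z := FinVSet Zfin.
have YZ : Y `<=` Z by exact: subsetUl.
have NZ : initial R N `<=` Z by exact: subsetUr.
have [u hu] := component_nonempty (dir_component h Z).
have [v fv] := component_nonempty (dir_component f Z).
(* Both vertices lie in [f (initial R N)], a connected set disjoint from [Y]. *)
have uv : linked Y v u.
  have fu : f (initial R N) u by rewrite /f /= -agree; exact: dir_sub hu.
  have vf : f (initial R N) v by exact: dir_sub fv.
  apply: (linked_avoid (component_linked (dir_component f _) vf fu)) => z vz Yz.
  exact: out Yz (component_closed (dir_component f _) vf vz).
rewrite -fY; apply: (component_meet (dir_component h Y) (dir_component f Y) (v := u)).
  exact: dir_sub hu.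
apply: (component_closed (dir_component f Y)) uv.
exact: dir_sub fv.
Qed.

(** * (iii) => (iv) *)

Lemma directional_topological R : directional_ray R -> topological_ray R.
Proof.
move=> /directional_rayP dirR; set w := end_of R in dirR *.
split=> [_ [n _ <-]|V /nbhs_end[X XV]]; first by apply/nbhs_end; exists (initial R n).
have [N1 out1] := ray_leaves R (vset_finite X).
(* A vertex of [X] outside some [C(X_n, w)] stays outside the later ones, so one index serves the
   finite set [X]. *)
have [N2 N2P] : exists N, forall v, vset X v ->
    end_comp (initial R N) w v -> forall n, end_comp (initial R n) w v.
  apply: finite_set_eventually; first exact: vset_finite.
    move=> v m n mn Pm vn; apply: Pm; apply: end_compS vn; try exact: vset_finite.
    exact: initial_sub.
  move=> v _; have [all_v|nall] := pselect (forall n, end_comp (initial R n) w v).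
    by exists 0%N.
  suff [n nv] : exists n, ~ end_comp (initial R n) w v by exists n => /nv.
  by apply: contrapT => no; apply: nall => n; apply: contrapT => nv; apply: no; exists n.
pose N := maxn N1 N2.
exists (Omega_at (initial R N) w); first by exists N.
move=> e eN; apply: XV; rewrite /Omega_at /Omega /=; apply: contrapT => eX.
suff : end_direction e = end_direction w.
  by move=> /(congr1 (fun f : direction G => dirv f X)).
apply: dirR => n /=.
have Zfin : finite_set (X `|` initial R N).
  by rewrite finite_setU; split; exact: vset_finite.
have [T eE] := end_class e; have eT : end_rays e T by rewrite eE; exact: ray_equiv_refl.
have {}eE : e = end_of T by exact: end_of_ray.
(* [K] lies in [C(X, e) <> C(X, w)], hence is disjoint from [R]; any edge
   leaving it towards [R] ends in a vertex of [X] close to [w]. *)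
set K := end_comp (X `|` initial R N) e.
have [compK /(_ T eT) tailK] := end_compP e Zfin.
have KX : K `<=` end_comp X e.
  exact: end_compS (vset_finite X) Zfin (@subsetUl _ _ _).
have KN : K `<=` end_comp (initial R N) w.
  by rewrite -eN; exact: end_compS (vset_finite (initial R N)) Zfin (@subsetUr _ _ _).
have compX d := (end_compP d (vset_finite X)).1.
have compI d m := (end_compP d (vset_finite (initial R m))).1.
(* [K] avoids the first [N] vertices of [R] by definition; the later ones lie in [C(X, w)], as [R]
   has left [X] by [N1]. *)
have KR i : ~ K (R i).
  move=> Ki; have [iN|Ni] := ltnP i N.
    by apply: (component_out (compI w N) (KN _ Ki)); exists i.
  apply: eX; apply: (component_meet (compX e) (compX w) (KX _ Ki)).
  apply: ray_end_comp; first exact: vset_finite.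
  move=> m im; apply: out1; apply: leq_trans im; apply: leq_trans Ni.
  exact: leq_maxl.
have [t Kt] := component_nonempty compK.
have tR := component_linked (compI w N) (KN t Kt) (initial_end_comp R (leqnn N)).
have [x [y [tx xy Kx nKy Ny]]] := linked_exit tR Kt (@KR N).
have Xy : vset X y.
  apply: contrapT => nXy; apply: nKy; apply: (component_adj compK Kx xy).
  by move=> [].
have wy : end_comp (initial R N) w y.
  exact: component_adj (compI w N) (KN x Kx) xy Ny.
have wyn : end_comp (initial R n) w y.
  apply: N2P => //; apply: end_compS wy; try exact: vset_finite.
  by apply: initial_sub; exact: leq_maxr.
have xR : ~ vset (initial R n) x by move=> [i _ ix]; apply: (KR i); rewrite ix.
have wx : end_comp (initial R n) w x.
  exact: component_adj (compI w n) wyn (adj_sym xy) xR.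
(* A tail of [T] runs in [K], which is connected, avoids [R] and contains [x], a vertex of
   [C(X_n, w)]. *)
rewrite [in LHS]eE; apply: end_comp_ray; [exact: first_vertices_finite|exact: compI|].
have [m tailm] := tailK; exists m => k mk; have Kk := tailm k mk.
apply: (component_closed (compI w n) wx).
apply: (linked_avoid (component_linked compK Kx Kk)) => z xz [i _ iz].
by apply: (KR i); rewrite iz; exact: component_closed compK Kx xz.
Qed.

End Graph.

Theorem theorem3p2 (G : graph) (w : graph_end G) :
  [<-> first_countable_at w ;
       countably_determined (end_direction w) ;
       exists2 R : ray G, end_rays w R & directional_ray R ;
       exists2 R : ray G, end_rays w R & topological_ray R].
Proof.
tfae.
- exact: first_countable_determined.
- exact: determined_directional.
- by case=> R wR /directional_topological; exists R.
case=> R /end_of_ray-> topR.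
exists (range (fun n => Omega_at (first_vertices R n) (end_of R))) => //.
by apply: sub_countable (countableP setT); exact: card_image_le.
Qed.
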